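(* Let $K$ be a finite simplicial complex, let $f,g:K\to[0,1]$ be admissible functions, and let $p\ge 0$. Then $$\mathrm{dist}_{\mathcal{H},p,1}^{\mathrm{persistent}}\big(\mathcal{H}_p(K,f),\mathcal{H}_p(K,g)\big)\;\le\;\pi\cdot\left(\|f-g\|_1^{(p)}+\|f-g\|_1^{(p+1)}\right).$$
   Context: A finite simplicial complex $K$ is a set of (nonempty) subsets of $\{0,\dots,M\}$ for some $M$, closed under passing to (nonempty) subsets; $K^{[p]}$ is the set of its $p$-dimensional simplices. $C_p(K)$ is the real vector space with basis $K^{[p]}$, given the inner product for which $K^{[p]}$ is an orthonormal basis; $\partial_p:C_p(K)\to C_{p-1}(K)$ is the usual boundary map ($\partial_0=0$), $Z_p(K)=\ker\partial_p$, $B_p(K)=\mathrm{Im}\,\partial_{p+1}$. The harmonic homology subspace is $\mathcal{H}_p(K)=Z_p(K)\cap B_p(K)^\perp$. For a sub-complex $K'\subset K$, $C_p(K')\subset C_p(K)$, so $\mathcal{H}_p(K')$ is a subspace of $C_p(K)$. For subspaces $A,B$ of a finite-dimensional real inner product space $V$ with $\dim A=k$, $\dim B=\ell$, $$d_V(A,B)=\left(|k-\ell|\frac{\pi^2}{4}+\sum_{i=1}^{\min\{k,\ell\}}\theta_i^2\right)^{1/2},$$ where $\theta_i$ is the $i$-th principal angle between $A$ and $B$. A function $f:K\to\mathbb{R}$ is admissible if $f(\sigma)<f(\tau)$ whenever $\sigma$ is a proper face of $\tau$. Then $K_{f\le t}=f^{-1}((-\infty,t])$ is a sub-complex of $K$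 for each $t$. The harmonic filtration function $\mathcal{H}_p(K,f)$ is the map $t\mapsto\mathcal{H}_p(K_{f\le t})$ from $\mathbb{R}$ to the set of subspaces of $C_p(K)$. For piecewise constant maps $F,G$ with finitely many discontinuities from $\mathbb{R}$ to the set of subspaces of $C_p(K)$, and $\ell>0$, $$\mathrm{dist}_{\mathcal{H},p,\ell}^{\mathrm{persistent}}(F,G)=\left(\int_0^1\int_0^t d_{C_p(K)}(F^{s,t},G^{s,t})^\ell\,ds\,dt\right)^{1/\ell},$$ where $F^{s,t}=\mathrm{proj}_{F(t)}(F(s))$ and $G^{s,t}=\mathrm{proj}_{G(t)}(G(s))$ (images under orthogonal projection). For $h:K\to\mathbb{R}$ and $\ell>0$, $\|h\|_\ell^{(p)}=\left(\sum_{\sigma\in K^{[p]}}|h(\sigma)|^\ell\right)^{1/\ell}$. *)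

(* Defs.v *)
From HB Require Import structures.
From mathcomp Require Import all_boot all_order all_algebra.
From mathcomp Require Import sesquilinear.
From mathcomp Require Import all_classical all_reals all_analysis.

Set Implicit Arguments.
Unset Strict Implicit.
Unset Printing Implicit Defensive.

Import Order.TTheory GRing.Theory Num.Theory.
Local Open Scope ring_scope.

Section InnerProductSpace.
Local Open Scope classical_set_scope.
Variables (R : realType) (V : vectType R) (dot : {dot V for idfun}).
Implicit Types (A B U W : {vspace V}) (uv : nat -> V * V) (F G : R -> {vspace V}).

(* The constraints on the i-th pair of principal vectors, given the earlier
   pairs uv 0, ..., uv i.-1. *)
Definition principal_feasible A B uv (i : nat) (xy : V * V) : Prop :=
  [/\ xy.1 \in A, xy.2 \in B, dot xy.1 xy.1 = 1, dot xy.2 xy.2 = 1 &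
      forall j, (j < i)%N -> dot xy.1 (uv j).1 = 0 /\ dot xy.2 (uv j).2 = 0].

Definition principal_vectors A B uv : Prop :=
  forall i, (i < minn (\dim A) (\dim B))%N ->
    principal_feasible A B uv i (uv i) /\
    forall xy, principal_feasible A B uv i xy ->
      dot xy.1 xy.2 <= dot (uv i).1 (uv i).2.

(* Numbered from 0 and meaningful for i < minn (\dim A) (\dim B). Principal
   vectors exist but are not unique; the angles do not depend on their choice. *)
Definition principal_angle A B (i : nat) : R :=
  xget 0 [set theta | exists2 uv, principal_vectors A B uv &
                                  theta = acos (dot (uv i).1 (uv i).2)].

Definition subspace_dist A B : R :=
  Num.sqrt (`|(\dim A)%:R - (\dim B)%:R| * (pi ^+ 2 / 4) +
            \sum_(i < minn (\dim A) (\dim B)) principal_angle A B i ^+ 2).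

Definition ortho_proj W : 'End(V) := daddv_pi W (orthov dot W).

Definition persistent F (s t : R) : {vspace V} := (ortho_proj (F t) @: F s)%VS.

Definition persistent_dist (l : R) F G : \bar R :=
  poweR
    (\int[lebesgue_measure]_(t in `[0%R, 1%R])
      \int[lebesgue_measure]_(s in `[0%R, t])
        (subspace_dist (persistent F s t) (persistent G s t) `^ l)%:E)%E
    l^-1.

End InnerProductSpace.

Section StandardInnerProduct.
Variables (R : realType) (T : finType).
Implicit Types u v : {ffun T -> R^o}.

Definition ffdot u v : R := \sum_i u i * v i.

Fact ffdot_is_bilinear :
  bilinear_for *%R ( idfun \; *%R) (ffdot : {ffun T -> R^o} -> {ffun T -> R^o} -> R).
Proof.
split=> [w a u v|w a u v]; rewrite /ffdot /= mulr_sumr -big_split /=;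
  apply: eq_bigr => i _; rewrite !ffunE.
- by rewrite mulrDl mulrA.
- by rewrite mulrDr mulrCA.
Qed.

HB.instance Definition _ :=
  bilinear_isBilinear.Build R {ffun T -> R^o} {ffun T -> R^o} R
    *%R (idfun \; *%R) ffdot ffdot_is_bilinear.

Fact ffdot_sym u v : ffdot u v = (-1) ^+ false * idfun (ffdot v u).
Proof.
by rewrite expr0 mul1r /ffdot; apply: eq_bigr => i _; rewrite mulrC.
Qed.

HB.instance Definition _ :=
  @isHermitianSesquilinear.Build R {ffun T -> R^o} false idfun ffdot ffdot_sym.

Fact ffdot_gt0 u : u != 0 -> 0 < ffdot u u.
Proof.
move=> u0; have uu_ge0 i : true -> 0 <= u i * u i by rewrite -expr2 sqr_ge0.
rewrite lt_def sumr_ge0 // andbT; apply: contra u0.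
rewrite /ffdot psumr_eq0 // => /allP h; apply/eqP/ffunP => i; rewrite ffunE.
by have /implyP/(_ isT) := h i (mem_index_enum i); rewrite mulf_eq0 orbb => /eqP.
Qed.

HB.instance Definition _ :=
  @isDotProduct.Build R {ffun T -> R^o} ffdot ffdot_gt0.

End StandardInnerProduct.

Section SimplicialComplex.
Variable M : nat.
Implicit Types (K L : {set {set 'I_M.+1}}) (s t : {set 'I_M.+1}) (p : nat).

Definition simplicial_complex K : Prop :=
  finset.set0 \notin K /\
  forall s t, t \in K -> s \subset t -> s != finset.set0 -> s \in K.

Definition simplices K p : {set {set 'I_M.+1}} := [set s in K | #|s| == p.+1].

Variable R : realType.
Implicit Types f : {set 'I_M.+1} -> R.

(* A function K -> R is a total f of which only the values on K are used. *)
Definition admissible K f : Prop :=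
  forall s t, s \in K -> t \in K -> s \proper t -> f s < f t.

Definition sublevel K f (a : R) : {set {set 'I_M.+1}} := [set s in K | f s <= a].

Definition simplex_norm K p (l : R) f : R :=
  (\sum_(s in simplices K p) `|f s| `^ l) `^ l^-1.

End SimplicialComplex.

Notation simplex K p := {s | s \in simplices K p}.
Notation chain R K p := {ffun simplex K p -> R^o}.

Section Homology.
Variables (M : nat) (R : realType) (K : {set {set 'I_M.+1}}).
Implicit Types (L : {set {set 'I_M.+1}}) (s t : {set 'I_M.+1}) (p : nat).

(* The coefficient of t in the boundary of s = {v_0 < ... < v_q}: the face
   omitting v = v_i has sign (-1) ^ i, and i counts the vertices below v. *)
Definition incidence s t : R :=
  \sum_(v in s | s :\ v == t) (-1) ^+ #|[set w in s | (w < v)%N]|.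

Definition boundary p (c : chain R K p.+1) : chain R K p :=
  [ffun t => \sum_(s : simplex K p.+1) c s * incidence (val s) (val t)].

Fact boundary_is_linear p : linear (@boundary p).
Proof.
move=> a c d; apply/ffunP => t; rewrite !ffunE scaler_sumr -big_split /=.
by apply: eq_bigr => s _; rewrite !ffunE mulrDl -scalerAl.
Qed.

HB.instance Definition _ p :=
  GRing.isLinear.Build R (chain R K p.+1) (chain R K p) *:%R (@boundary p)
    (@boundary_is_linear p).

Definition basis_chain p (s : simplex K p) : chain R K p :=
  [ffun t => (t == s)%:R].

(* Below, L is a subcomplex of K, and the spaces attached to L are subspaces
   of the chain spaces of K. *)
Definition subchains L p : {vspace chain R K p} :=
  (\sum_(s : simplex K p | val s \in L) <[basis_chain s]>)%VS.

Definition cycles L p : {vspace chain R K p} :=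
  match p return {vspace chain R K p} with
  | 0 => subchains L 0
  | q.+1 => (subchains L q.+1 :&: lker (linfun (@boundary q)))%VS
  end.

Definition boundaries L p : {vspace chain R K p} :=
  (linfun (@boundary p) @: subchains L p.+1)%VS.

Definition harmonic_space L p : {vspace chain R K p} :=
  (cycles L p :&: orthov (@ffdot R (simplex K p)) (boundaries L p))%VS.

Definition harmonic_filtration p (f : {set 'I_M.+1} -> R) (a : R) :
    {vspace chain R K p} :=
  harmonic_space (sublevel K f a) p.

End Homology.

(* Main.v *)
Require Import Defs.
From mathcomp Require Import all_boot all_order all_algebra.
From mathcomp Require Import sesquilinear.
From mathcomp Require Import all_classical all_reals all_analysis.
From mathcomp Require Import measurable_realfun.
From mathcomp Require Import zify ring lra.

Set Implicit Arguments.
Unset Strict Implicit.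
Unset Printing Implicit Defensive.

Import Order.TTheory GRing.Theory Num.Theory.
Local Open Scope ring_scope.

(** Write [e A B = \dim (A :\: B)] for the codimension of [A :&: B] in [A]. It
    obeys the triangle inequality, does not increase under linear images, and
    adds up under intersections; so it propagates through every construction
    that enters the persistent distance, and turns the theorem into a count.

    - The distance is controlled by [e]. The first [\dim (A :&: B)] principal
      angles vanish and the others are at most [pi / 2], so the squared distance
      is at most [(pi / 2)^2 m] with [m = max (e A B) (e B A)]; as [m] is a
      natural number, [sqrt m <= m] ([subspace_dist_le]).
    - Harmonic spaces vary little. Such a space is the intersection of the
      cycles with the orthogonal complement of the boundaries. From [L] to [L'],
      the cycles contribute to [e] at most the number of [p]-simplices of [L]
      outside [L'], and the orthogonal complements at most the number of
      [p.+1]-simplices of [L'] outside [L] ([dimv_diff_harmonic_space]).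
    - Projections vary little. The projections onto [A] and [B] agree on
      [A :&: B] and on the orthogonal complement of [A + B], hence differ by a
      map of rank at most [e A B + e B A] ([dim_ortho_projB]).

    Together, if [n a] is the number of [p]- and [p.+1]-simplices that belong to
    exactly one of the two sublevel complexes at [a], the integrand at [(s, t)]
    is at most [pi / 2 * (n s + n t)]. A simplex [x] contributes to [n] exactly
    between [f x] and [g x], so the integral of [n] over the unit interval is at
    most the sum [N] of the two norms. Enlarging the triangle [s <= t] to the
    unit square gives [pi / 2 * (N + N) = pi * N]. *)

(** * Codimension of an intersection *)

Section SubspaceDifference.
Variables (F : fieldType) (vT : vectType F).
Implicit Types (A B C D X Y : {vspace vT}).
Local Open Scope nat_scope.

(** Since [A :\: B] is a complement of [B] in [A + B], any [D] that generates
    [A] modulo [B] is at least as large. Exhibiting such a [D] is the usual way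
    to bound [\dim (A :\: B)] from above. *)
Lemma dimv_diff_le A B D : (A <= B + D)%VS -> \dim (A :\: B) <= \dim D.
Proof.
move=> sABD; have /dimvS : (A :\: B + B <= B + D)%VS.
  by rewrite addv_diff subv_add sABD addvSl.
rewrite (dimv_disjoint_sum (capv_diff A B)) => le1.
have le2 := leq_trans le1 (dimv_add_leqif B D).1.
by rewrite -(leq_add2r (\dim B)) (addnC (\dim D)).
Qed.

Lemma subv_add_diff A B : (A <= B + (A :\: B))%VS.
Proof. by rewrite addvC addv_diff addvSl. Qed.

Lemma dimv_diffS A B C : (A <= B)%VS -> \dim (A :\: C) <= \dim (B :\: C).
Proof. by move=> sAB; exact/dimv_diff_le/(subv_trans sAB)/subv_add_diff. Qed.

Lemma dimv_diff_trans A B C :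
  \dim (A :\: C) <= \dim (A :\: B) + \dim (B :\: C).
Proof.
apply: leq_trans (dimv_add_leqif (A :\: B) (B :\: C)).1.
apply/dimv_diff_le/(subv_trans (subv_add_diff A B)).
by rewrite (addvC (A :\: B)%VS) addvA addvS // subv_add_diff.
Qed.

Lemma dimv_diff_cap A B X Y :
  \dim ((A :&: X) :\: (B :&: Y))%VS <= \dim (A :\: B) + \dim (X :\: Y).
Proof.
set U := (A :&: X)%VS.
(* Cut U by B first, then U :&: B by Y. *)
have UB := dimv_cap_compl U B; have UBY := dimv_cap_compl (U :&: B) Y.
have := dimv_cap_compl U (B :&: Y); rewrite capvA.
have : \dim (U :\: B) <= \dim (A :\: B) by rewrite dimv_diffS ?capvSl.
have : \dim ((U :&: B) :\: Y) <= \dim (X :\: Y).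
  by rewrite dimv_diffS // (subv_trans (capvSl _ _)) ?capvSr.
lia.
Qed.

Lemma dimv_diff_sym A B :
  \dim (A + B) = \dim (A :&: B) + (\dim (A :\: B) + \dim (B :\: A)).
Proof.
have := dimv_cap_compl A B; have := dimv_cap_compl B A.
have := dimv_sum_cap A B; rewrite (capvC B A); lia.
Qed.

End SubspaceDifference.

Section SubspaceDifferenceImage.
Variables (F : fieldType) (vT wT : vectType F).
Implicit Types (A B U : {vspace vT}) (h k : 'Hom(vT, wT)).
Local Open Scope nat_scope.

Lemma dim_limg_le h U : \dim (h @: U)%VS <= \dim U.
Proof. by rewrite -(limg_ker_dim h U) leq_addl. Qed.

Lemma dimv_diff_limg h A B :
  \dim ((h @: A) :\: (h @: B))%VS <= \dim (A :\: B).
Proof.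
apply: leq_trans (dim_limg_le h _); apply: dimv_diff_le.
by rewrite -limgD limgS // subv_add_diff.
Qed.

(** On [U], [h] and [k] differ by the values of [h - k]. *)
Lemma dimv_diff_limg2 h k U :
  \dim ((h @: U) :\: (k @: U))%VS <= \dim ((h - k)%R @: U)%VS.
Proof.
apply: dimv_diff_le; apply/subvP => _ /memv_imgP[u Uu ->].
have -> : (h u = k u + (h - k) u)%R by rewrite !lfun_simp addrC subrK.
by rewrite memv_add ?memv_img.
Qed.

End SubspaceDifferenceImage.

(** * Orthogonal complements and projections *)

Section Orthogonal.
Variables (R : realType) (V : vectType R) (dot : {dot V for idfun}).
Implicit Types (A B U W X Y : {vspace V}).
Local Notation orth := (orthov dot).

(** Each vector imposes one linear condition. *)
Lemma dim_cap_orthov_lines U (u : nat -> V) n :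
  (\dim U <= \dim (U :&: \bigcap_(i < n) (orth <[u i]>)) + n)%N.
Proof.
elim: n => [|n IH]; first by rewrite big_ord0 capvf addn0.
rewrite big_ord_recr /= capvA.
apply: leq_trans IH _; rewrite addnS -addSn leq_add2r.
apply: leq_trans (leqSpred _) _; rewrite ltnS.
exact: leq_dim_orthov1.
Qed.

Lemma dim_cap_orthov U W : (\dim U <= \dim (U :&: (orth W)) + \dim W)%N.
Proof.
(* The complement is cut out by the vectors of a basis of W. *)
rewrite /orthov; under eq_bigr do rewrite -orthov1E.
exact: dim_cap_orthov_lines.
Qed.

Lemma capv_orthov W : (W :&: (orth W) = 0)%VS.
Proof.
apply/eqP; rewrite -subv0.
apply/subvP => w /memv_capP[Ww /mem_orthovP/(_ w Ww)].
move=> ww0; rewrite memv0; apply: contraT => /(neq0_dnorm_gt0 (s := dot)).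
by rewrite ww0 ltxx.
Qed.

Lemma addv_orthov W : (W + (orth W) = fullv)%VS.
Proof.
apply/eqP; rewrite eqEdim subvf /= dimv_disjoint_sum ?capv_orthov //.
by have := dim_cap_orthov fullv W; rewrite capfv addnC.
Qed.

(** A vector orthogonal to [X] is orthogonal to [Y] as soon as it is orthogonal
    to a complement of [X] in [X + Y]. *)
Lemma dimv_diff_orthov X Y : (\dim ((orth X) :\: (orth Y)) <= \dim (Y :\: X))%N.
Proof.
have := dimv_cap_compl (orth X) (orth Y).
have := dim_cap_orthov (orth X) (Y :\: X).
suff /dimvS : (orth X :&: orth (Y :\: X) <= orth X :&: orth Y)%VS by lia.
rewrite subv_cap capvSl orthov_sym.
apply: subv_trans (subv_add_diff Y X) _; rewrite orthov_sym orthovD.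
by rewrite capvSl capvSr.
Qed.

Lemma ortho_proj_id W w : w \in W -> ortho_proj dot W w = w.
Proof. exact/daddv_pi_id/capv_orthov. Qed.

Lemma ortho_proj_orthov W w : w \in (orth W) -> ortho_proj dot W w = 0.
Proof.
move=> w_orth; have : w \in (W + (orth W))%VS by rewrite addv_orthov memvf.
move=> /(daddv_pi_add (capv_orthov W)); rewrite /ortho_proj.
rewrite (daddv_pi_id _ w_orth); last by rewrite capvC capv_orthov.
by move/(canRL (addrK _)); rewrite subrr.
Qed.

(** The two projections agree on [A :&: B], where both are the identity, and on
    the orthogonal complement of [A + B], where both vanish; the codimension of
    the sum of these spaces is [\dim (A + B) - \dim (A :&: B)]. *)
Lemma dim_ortho_projB A B :
  (\dim ((ortho_proj dot A - ortho_proj dot B)%R @: fullv) <=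
   \dim (A :\: B) + \dim (B :\: A))%N.
Proof.
set h := (ortho_proj dot A - _)%R; have := limg_ker_dim h fullv.
have : ((A :&: B) + (orth (A + B)) <= lker h)%VS.
  rewrite subv_add; apply/andP; split; apply/subvP => v.
    case/memv_capP => Av Bv.
    by rewrite memv_ker !lfun_simp !ortho_proj_id ?subrr.
  rewrite memvE orthovD -!memvE => /andP[Av Bv].
  by rewrite memv_ker !lfun_simp !ortho_proj_orthov ?subrr.
move=> /dimvS; rewrite dimv_disjoint_sum; last first.
  apply/eqP; rewrite -subv0 -(capv_orthov (A + B)%VS) capvS //.
  by rewrite (subv_trans (capvSl A B)) ?addvSl.
have := dim_cap_orthov fullv (A + B); rewrite !capfv (dimv_diff_sym A B); lia.
Qed.

(** Interpolate through the projection of [Y] onto [A]: first change the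
    projected space, then the target of the projection. *)
Lemma dimv_diff_ortho_proj A B X Y :
  (\dim ((ortho_proj dot A @: X) :\: (ortho_proj dot B @: Y)) <=
   \dim (X :\: Y) + (\dim (A :\: B) + \dim (B :\: A)))%N.
Proof.
apply: leq_trans (dimv_diff_trans _ (ortho_proj dot A @: Y) _) _.
apply: leq_add; first exact: dimv_diff_limg.
apply: leq_trans (dimv_diff_limg2 _ _ _) _.
exact/(leq_trans _ (dim_ortho_projB A B))/dimvS/limgS/subvf.
Qed.

End Orthogonal.

(** * Principal angles *)

Section PrincipalAngles.
Variable R : realType.

Lemma acos_ge0_lepihalf (x : R) : 0 <= x <= 1 -> 0 <= acos x <= pi / 2.
Proof.
move=> /andP[x0 x1]; have x11 : -1 <= x <= 1 by rewrite x1 andbT; lra.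
rewrite acos_ge0 //= leNgt; apply: contraL x0 => acos_gt.
have pi0 : 0 <= pi :> R := pi_ge0 R.
rewrite -ltNge -{1}(acosK x11) -(cos_pihalf R) ltr_cos //.
  by rewrite in_itv /=; apply/andP; split; lra.
by rewrite in_itv /= acos_ge0 // acos_lepi.
Qed.

Variables (V : vectType R) (dot : {dot V for idfun}).
Implicit Types (u v : V) (A B W : {vspace V}) (uv : nat -> V * V).

Lemma dot_sym u v : dot u v = dot v u.
Proof. by rewrite hermC expr0 mul1r. Qed.

Lemma dot_unit_subE u v : dot u u = 1 -> dot v v = 1 ->
  dot (u - v) (u - v) = 2 * (1 - dot u v).
Proof.
move=> u1 v1; rewrite linearBl !linearB /= u1 v1 (dot_sym v u); ring.
Qed.

Lemma dot_ge0 u : 0 <= dot u u.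
Proof.
have [->|/neq0_dnorm_gt0 u0] := eqVneq u 0; first by rewrite linear0.
exact/ltW/u0.
Qed.

Lemma dot_unit_le1 u v : dot u u = 1 -> dot v v = 1 -> dot u v <= 1.
Proof.
by move=> u1 v1; have := dot_ge0 (u - v); rewrite dot_unit_subE //; lra.
Qed.

Lemma dot_unit_ge1_eq u v :
  dot u u = 1 -> dot v v = 1 -> 1 <= dot u v -> u = v.
Proof.
move=> u1 v1 uv1; apply/eqP; rewrite -subr_eq0; apply: contraT => uv0.
have := neq0_dnorm_gt0 (s := dot) _ uv0.
by rewrite dot_unit_subE //; lra.
Qed.

Lemma exists_unit_orthogonal W (u : nat -> V) n : (n < \dim W)%N ->
  exists w, [/\ w \in W, dot w w = 1 & forall j, (j < n)%N -> dot w (u j) = 0].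
Proof.
move=> n_lt; set D := (W :&: \bigcap_(i < n) orthov dot <[u i]>)%VS.
have D0 : vpick D != 0.
  rewrite vpick0 -dimv_eq0 -lt0n.
  by have := dim_cap_orthov_lines dot W u n; rewrite -/D; lia.
have /memv_capP[Ww /subv_bigcapP w_orth] := memv_pick D.
have w_gt0 := neq0_dnorm_gt0 (s := dot) _ D0.
exists ((Num.sqrt (dot (vpick D) (vpick D)))^-1 *: vpick D); split.
- exact: memvZ.
- rewrite linearZr_LR /= linearZl_LR /= mulrA -invfM -expr2 sqr_sqrtr ?ltW //.
  by rewrite mulVf // gt_eqF.
- move=> j jn; have := w_orth (Ordinal jn) isT.
  by rewrite -memvE mem_orthov1 linearZl_LR /= => /eqP ->; rewrite mulr0.
Qed.

(** By induction the earlier pairs are diagonal, so a unit vector of [A :&: B]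
    orthogonal to them is feasible on both sides at once, and paired with itself
    it reaches the value 1, which only equal unit vectors attain. *)
Lemma principal_vectors_cap A B uv i :
  principal_vectors dot A B uv -> (i < \dim (A :&: B))%N ->
  (uv i).1 = (uv i).2.
Proof.
move=> uvP; elim/ltn_ind: i => i IH i_lt.
have i_min : (i < minn (\dim A) (\dim B))%N.
  rewrite leq_min !(leq_trans i_lt) ?dimvS ?capvSl ?capvSr //.
have [[_ _ u1 v1 _] uv_max] := uvP i i_min.
have [w [/memv_capP[Aw Bw] w1 w_orth]] :=
  exists_unit_orthogonal (fun j => (uv j).1) i_lt.
apply: dot_unit_ge1_eq => //; rewrite -w1; apply: (uv_max (w, w)).
split=> // j ji /=; split; first exact: w_orth.
by rewrite -IH ?w_orth // (ltn_trans ji).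
Qed.

(** The cosine is nonnegative because feasibility is stable under changing the
    sign of one vector of the pair. *)
Lemma principal_vectors_dot A B uv i :
  principal_vectors dot A B uv -> (i < minn (\dim A) (\dim B))%N ->
  0 <= dot (uv i).1 (uv i).2 <= 1.
Proof.
move=> uvP i_min; have [[Au Bv u1 v1 uv_orth] uv_max] := uvP i i_min.
rewrite dot_unit_le1 // andbT.
have := uv_max ((uv i).1, - (uv i).2); rewrite /= linearN /=.
suff uvN : principal_feasible dot A B uv i ((uv i).1, - (uv i).2).
  by move=> /(_ uvN); lra.
split=> //=; first by rewrite memvN.
  by rewrite linearNl linearN opprK.
by move=> j /uv_orth[uj vj]; split; rewrite /= ?linearNl /= ?vj ?oppr0.
Qed.

Lemma principal_angle_cap A B i :
  (i < \dim (A :&: B))%N -> principal_angle dot A B i = 0.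
Proof.
move=> i_lt; rewrite /principal_angle; case: xgetP => // _ _ [uv uvP ->].
have i_min : (i < minn (\dim A) (\dim B))%N.
  rewrite leq_min !(leq_trans i_lt) ?dimvS ?capvSl ?capvSr //.
have [[_ _ u1 _ _] _] := uvP i i_min.
by rewrite -(principal_vectors_cap uvP i_lt) u1 acos1.
Qed.

Lemma principal_angle_bound A B i : (i < minn (\dim A) (\dim B))%N ->
  0 <= principal_angle dot A B i <= pi / 2.
Proof.
move=> i_min; rewrite /principal_angle; case: xgetP => [_ _ [uv uvP ->]|_].
  exact/acos_ge0_lepihalf/(principal_vectors_dot uvP).
by rewrite lexx divr_ge0 ?pi_ge0.
Qed.

Lemma sum_principal_angle_le A B n : (n <= minn (\dim A) (\dim B))%N ->
  \sum_(i < n) principal_angle dot A B i ^+ 2 <=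
    (n - \dim (A :&: B))%:R * (pi ^+ 2 / 4).
Proof.
elim: n => [_|n IH n_min]; first by rewrite big_ord0 mul0r.
have {}IH := IH (ltnW n_min); rewrite big_ord_recr /=.
have [cn|nc] := leqP (\dim (A :&: B)) n; last first.
  rewrite principal_angle_cap // expr0n addr0 (le_trans IH) //.
  by rewrite ler_wpM2r ?ler_nat ?leq_sub2r // divr_ge0 ?sqr_ge0.
rewrite subSn // -natr1 mulrDl mul1r lerD //.
have /andP[a0 a1] := principal_angle_bound n_min.
have -> : pi ^+ 2 / 4 = (pi / 2) ^+ 2 :> R by rewrite expr_div_n -natrX.
by rewrite ler_sqr ?nnegrE ?divr_ge0 ?pi_ge0.
Qed.

Lemma subspace_dist_le A B :
  subspace_dist dot A B <=
    pi / 2 * (maxn (\dim (A :\: B)) (\dim (B :\: A)))%:R.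
Proof.
set m := maxn _ _; have pi0 : 0 <= pi / 2 :> R by rewrite divr_ge0 ?pi_ge0.
(* The bound is read as the square root of its square. *)
rewrite -(ger0_norm (mulr_ge0 pi0 (ler0n _ m))) -sqrtr_sqr ler_wsqrtr //.
have pi4 : 0 <= pi ^+ 2 / 4 :> R by rewrite divr_ge0 ?sqr_ge0.
have -> : `|(\dim A)%:R - (\dim B)%:R| =
    (maxn (\dim A) (\dim B) - minn (\dim A) (\dim B))%:R :> R.
  case: (leqP (\dim A) (\dim B)) => [AB|/ltnW BA].
    by rewrite distrC -natrB // ger0_norm.
  by rewrite -natrB // ger0_norm.
apply: le_trans (lerD (lexx _) (sum_principal_angle_le (leqnn _))) _.
rewrite -mulrDl -natrD.
have cA := dimv_cap_compl A B; have := dimv_cap_compl B A; rewrite capvC => cB.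
(* The unmatched dimensions and the possibly nonzero angles are m in number, *)
(* and each weighs pi ^+ 2 / 4.                                              *)
have -> : (maxn (\dim A) (\dim B) - minn (\dim A) (\dim B) +
    (minn (\dim A) (\dim B) - \dim (A :&: B)) = m)%N by rewrite /m; lia.
have -> : (pi / 2 * m%:R) ^+ 2 = (m ^ 2)%:R * (pi ^+ 2 / 4) :> R.
  by rewrite natrX; field.
by rewrite ler_wpM2r // ler_nat; case: (m) => // k; rewrite leq_pmulr.
Qed.

End PrincipalAngles.

(** * Harmonic spaces of two subcomplexes *)

Section HarmonicPerturbation.
Variables (R : realType) (M : nat) (K : {set {set 'I_M.+1}}).
Implicit Types (L : {set {set 'I_M.+1}}) (p : nat).
Local Open Scope nat_scope.

Definition extra_simplices p L L' : nat := #|simplices K p :&: (L :\: L')|.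

Lemma dim_span_basis_chains p (P : pred (simplex K p)) :
  \dim (\sum_(s | P s) <[basis_chain R s]>)%VS <= #|P|.
Proof.
apply: leq_trans (dimv_leq_sum _ _ _) _; rewrite -sum1_card.
by apply: leq_sum => s _; rewrite dim_vline leq_b1.
Qed.

Lemma dimv_diff_subchains L L' p :
  \dim (subchains R K L p :\: subchains R K L' p) <= extra_simplices p L L'.
Proof.
pose P := [pred s : simplex K p | (val s \in L) && (val s \notin L')].
have /dimv_diff_le : (subchains R K L p <=
    subchains R K L' p + \sum_(s | P s) <[basis_chain R s]>)%VS.
  apply/subv_sumP => s sL; have [sL'|sL'] := boolP (val s \in L').
    by apply: subv_trans (addvSl _ _); apply: (sumv_sup s).
  by apply: subv_trans (addvSr _ _); apply: (sumv_sup s) => //=; rewrite sL.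
move/leq_trans; apply; apply: leq_trans (dim_span_basis_chains P) _.
rewrite -(fintype.card_image val_inj P); apply: subset_leq_card.
apply/fintype.subsetP => _ /fintype.imageP[s /andP[sL sL'] ->].
by rewrite finset.in_setI finset.in_setD sL sL' (valP s).
Qed.

(** The roles of [L] and [L'] are exchanged for [p.+1]-simplices: enlarging the
    complex enlarges the boundaries, hence shrinks their orthogonal
    complement. *)
Lemma dimv_diff_harmonic_space L L' p :
  \dim (harmonic_space R K L p :\: harmonic_space R K L' p) <=
    extra_simplices p L L' + extra_simplices p.+1 L' L.
Proof.
apply: leq_trans (dimv_diff_cap _ _ _ _) _; apply: leq_add.
  case: p => [|p]; first exact: dimv_diff_subchains.
  apply: leq_trans (dimv_diff_cap _ _ _ _) _.
  (* Both spaces of cycles are cut out by the same boundary map. *)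
  rewrite (_ : \dim (lker _ :\: lker _) = 0) ?addn0.
    exact: dimv_diff_subchains.
  by apply/eqP; rewrite dimv_eq0 diffv_eq0.
apply: leq_trans (dimv_diff_orthov _ _ _) _.
exact: leq_trans (dimv_diff_limg _ _ _) (dimv_diff_subchains _ _ _).
Qed.

End HarmonicPerturbation.

(** * Persistent subspaces of two filtrations *)

Section PersistentPerturbation.
Variables (R : realType) (V : vectType R) (dot : {dot V for idfun}).
Implicit Types (F G : R -> {vspace V}).
Local Open Scope nat_scope.

Definition dim_symdiff F G (a : R) : nat :=
  \dim (F a :\: G a) + \dim (G a :\: F a).

Lemma dimv_diff_persistent F G s t :
  \dim (persistent dot F s t :\: persistent dot G s t) <=
    \dim (F s :\: G s) + dim_symdiff F G t.
Proof. exact: dimv_diff_ortho_proj. Qed.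

Lemma subspace_dist_persistent_le F G s t :
  (subspace_dist dot (persistent dot F s t) (persistent dot G s t) <=
    pi / 2 * ((dim_symdiff F G s)%:R + (dim_symdiff F G t)%:R))%R.
Proof.
apply: le_trans (subspace_dist_le _ _ _) _.
rewrite ler_wpM2l ?divr_ge0 ?pi_ge0 // -natrD ler_nat.
have := dimv_diff_persistent F G s t; have := dimv_diff_persistent G F s t.
rewrite /dim_symdiff; lia.
Qed.

End PersistentPerturbation.

(** * Bounding the iterated integral *)

Section IteratedIntegral.
Variable R : realType.
Local Notation mu := (@lebesgue_measure R).
Local Open Scope classical_set_scope.
Local Open Scope ereal_scope.

(** The integral of a nonnegative function, measurable or not, is a supremum
    over the simple functions below it. This spares checking that the distance
    and its inner integral depend measurably on the levels. *)
Lemma ge0_le_integral_dominated d (T : measurableType d)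
    (nu : {measure set T -> \bar R}) (D : set T) (h k : T -> \bar R) :
  (forall x, D x -> 0 <= h x) -> (forall x, D x -> h x <= k x) ->
  \int[nu]_(x in D) h x <= \int[nu]_(x in D) k x.
Proof.
move=> h0 hk; have k0 x : D x -> 0 <= k x.
  by move=> Dx; exact: le_trans (h0 x Dx) (hk x Dx).
rewrite !ge0_integralE //=; apply: ereal_sup_le => _ [u /= uh <-].
exists u => // x; apply: le_trans (uh x) _.
by rewrite !patchE; case: ifPn => // /set_mem; exact: hk.
Qed.

Variables (m : R -> R) (N : R).
Hypotheses (m0 : forall x, (0 <= m x)%R) (mm : measurable_fun setT m).
Hypothesis mN : \int[mu]_(x in `[0%R, 1%R]) (m x)%:E <= N%:E.

Lemma integral_affine_le (c b : R) : (0 <= c)%R -> (0 <= b)%R ->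
  \int[mu]_(x in `[0%R, 1%R]) (c * (b + m x))%:E <= (c * (b + N))%:E.
Proof.
move=> c0 b0.
have mm01 : measurable_fun (`[0%R, 1%R] : set R) (EFin \o m).
  by apply/measurable_EFinP; exact: measurable_funS mm.
under eq_integral do rewrite EFinM EFinD.
rewrite ge0_integralZl //; first last.
- by move=> x _; rewrite adde_ge0 // lee_fin.
- exact: emeasurable_funD.
rewrite ge0_integralD //; first last.
- by move=> x _; rewrite lee_fin.
rewrite integral_cst //= lebesgue_measure_itv /= lte_fin ltr01 sube0 mule1.
by rewrite EFinM EFinD lee_wpmul2l ?lee_fin // leeD2l.
Qed.

(** Extending the inner integral to the whole unit interval makes the bounds in
    [s] and in [t] independent, and each of them costs [N]. *)
Lemma iterated_integral_le (h : R -> R -> R) (c : R) : (0 <= c)%R ->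
  (forall s t, (0 <= h s t <= c * (m s + m t))%R) ->
  \int[mu]_(t in `[0%R, 1%R]) \int[mu]_(s in `[0%R, t]) (h s t)%:E <=
    (c * (N + N))%:E.
Proof.
move=> c0 hm; have N0 : (0 <= N)%R.
  rewrite -lee_fin (le_trans _ mN) // integral_ge0 // => x _.
  by rewrite lee_fin.
apply: le_trans (integral_affine_le c0 N0).
apply: ge0_le_integral_dominated => [t _|t].
  by apply: integral_ge0 => s _; rewrite lee_fin; case/andP: (hm s t).
rewrite /= in_itv /= => /andP[t0 t1].
rewrite [X in (c * X)%R]addrC; apply: le_trans (integral_affine_le c0 (m0 t)).
apply: (@le_trans _ _ (\int[mu]_(s in `[0%R, t]) (c * (m t + m s))%:E)).
  apply: ge0_le_integral_dominated => s _; case/andP: (hm s t) => // h0 h1.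
  by rewrite lee_fin addrC.
apply: ge0_subset_integral => //.
- apply/measurable_EFinP; apply: measurable_funM => //.
  apply: measurable_funD => //; exact: measurable_funS mm.
- by move=> s _; rewrite lee_fin mulr_ge0 // addr_ge0.
- by apply: subset_itvl; rewrite bnd_simp.
Qed.

End IteratedIntegral.

(** * Counting the simplices on which two filtrations disagree *)

Section Mismatch.
Variables (R : realType) (M : nat) (K : {set {set 'I_M.+1}}).
Implicit Types (p : nat) (f g : {set 'I_M.+1} -> R).
Local Open Scope classical_set_scope.

(** This counts the [p]-simplices in exactly one of the sublevel complexes of
    [f] and [g] at level [a], written with indicators so as to be integrated
    term by term. The intervals are half-open because sublevels are closed: the
    simplex is present for [f] and absent for [g] when [f s <= a < g s]. *)
Definition mismatch f g p (a : R) : R :=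
  \sum_(s in simplices K p) (\1_`[f s, g s[ a + \1_`[g s, f s[ a).

Lemma mismatch_ge0 f g p a : 0 <= mismatch f g p a.
Proof. by apply: sumr_ge0 => s _; rewrite addr_ge0. Qed.

Lemma measurable_mismatch f g p : measurable_fun setT (mismatch f g p).
Proof.
rewrite /mismatch; under eq_fun do rewrite -big_filter.
apply: measurable_sum => s.
by apply: measurable_funD; exact: measurable_indic.
Qed.

Lemma extra_simplices_sublevel f g p a :
  (extra_simplices K p (sublevel K f a) (sublevel K g a))%:R =
    \sum_(s in simplices K p) \1_`[f s, g s[ a :> R.
Proof.
rewrite /extra_simplices -sum1_card natr_sum.
under eq_bigl do rewrite finset.in_setI.
rewrite big_mkcondr; apply: eq_bigr => s; rewrite inE => /andP[sK _].
rewrite indicE mem_setE in_itv /= ltNge !inE sK /= andbC.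
by case: ifP.
Qed.

Lemma integral_mismatch_le f g p :
  (\int[lebesgue_measure]_(a in `[0%R, 1%R]) (mismatch f g p a)%:E <=
    (simplex_norm K p 1 (f \- g))%:E)%E.
Proof.
have m1 (u v : R) : measurable_fun (`[0%R, 1%R] : set R)
    (fun a => (\1_`[u, v[ a : R)%:E).
  by apply/measurable_EFinP; exact: measurable_indic.
have norm1E : simplex_norm K p 1 (f \- g) =
    \sum_(s in simplices K p) `|f s - g s|.
  rewrite /simplex_norm invr1 powRr1 ?sumr_ge0 //.
  by apply: eq_bigr => s _; rewrite powRr1.
(* Each simplex s contributes at most the lengths of [f s, g s[ and of        *)
(* [g s, f s[: one is empty, the other has length |f s - g s|.                *)
rewrite norm1E /mismatch; under eq_integral do rewrite -sumEFin -big_filter.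
rewrite ge0_integral_sum //; last first.
  move=> s; apply/measurable_EFinP.
  by apply: measurable_funD; exact: measurable_indic.
rewrite big_filter -sumEFin; apply: lee_sum => s _.
under eq_integral do rewrite EFinD.
rewrite ge0_integralD //; [|exact: m1|exact: m1].
rewrite !integral_indic //.
have muI (u v : R) : (lebesgue_measure (`[u, v[ `&` `[0%R, 1%R]) <=
    (Num.max (v - u) 0)%:E)%E.
  apply: le_trans (le_measure _ _ _ (@subIsetl _ _ _)) _; rewrite ?inE //.
    exact: measurableI.
  rewrite /= lebesgue_measure_itv /= lte_fin -EFinB.
  by case: ifP => _; rewrite lee_fin le_max ?lexx ?orbT.
apply: le_trans (leeD (muI _ _) (muI _ _)) _.
rewrite -EFinD lee_fin -(opprB (f s)); set x := f s - g s.
by case: (leP x 0); case: (leP (- x) 0); case: (ler0P x); lra.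
Qed.

Lemma dim_symdiff_harmonic_filtration_le f g p a :
  (dim_symdiff (harmonic_filtration K p f) (harmonic_filtration K p g) a)%:R <=
    mismatch f g p a + mismatch f g p.+1 a :> R.
Proof.
rewrite /mismatch !big_split /= -!extra_simplices_sublevel -!natrD ler_nat.
apply: leq_trans (leq_add (dimv_diff_harmonic_space _ _ _ _ _)
  (dimv_diff_harmonic_space _ _ _ _ _)) _.
lia.
Qed.

End Mismatch.

Theorem theorem3p21 (R : realType) (M : nat) (K : {set {set 'I_M.+1}})
    (f g : {set 'I_M.+1} -> R) (p : nat)
    (hK : simplicial_complex K)
    (hf : admissible K f) (hg : admissible K g)
    (hf01 : forall s, s \in K -> 0 <= f s <= 1)
    (hg01 : forall s, s \in K -> 0 <= g s <= 1) :
  (persistent_dist (@ffdot R (simplex K p)) 1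
     (harmonic_filtration K p f) (harmonic_filtration K p g)
   <= (pi * (simplex_norm K p 1 (f \- g) +
             simplex_norm K p.+1 1 (f \- g)))%:E)%E.
Proof.
have d0 A B : 0 <= subspace_dist (@ffdot R (simplex K p)) A B :> R.
  exact: sqrtr_ge0.
rewrite /persistent_dist invr1 poweRe1; last first.
  apply: integral_ge0 => t _; apply: integral_ge0 => s _.
  by rewrite lee_fin powR_ge0.
pose m a := mismatch K f g p a + mismatch K f g p.+1 a.
set N := simplex_norm K p 1 _ + _.
have -> : pi * N = pi / 2 * (N + N) by field.
apply: (@iterated_integral_le _ m).
- by move=> a; rewrite addr_ge0 ?mismatch_ge0.
- by apply: measurable_funD; exact: measurable_mismatch.
- under eq_integral do rewrite EFinD.
  rewrite ge0_integralD //=; last 4 first.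
  + by move=> a _; rewrite lee_fin mismatch_ge0.
  + apply/measurable_EFinP.
    exact: measurable_funS (measurable_mismatch _ _ _ _).
  + by move=> a _; rewrite lee_fin mismatch_ge0.
  + apply/measurable_EFinP.
    exact: measurable_funS (measurable_mismatch _ _ _ _).
  by rewrite EFinD leeD // integral_mismatch_le.
- by rewrite divr_ge0 ?pi_ge0.
- move=> s t; rewrite powRr1 // d0 /=.
  apply: le_trans (subspace_dist_persistent_le _ _ _ _ _) _.
  rewrite ler_wpM2l ?divr_ge0 ?pi_ge0 //.
  by rewrite lerD // dim_symdiff_harmonic_filtration_le.
Qed.
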